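(* Let $k, h \in \mathbb N$, with no conditions on their relative growth rates, and let \[ T_k(h) := \sum_{\substack{h_1, \dots, h_k \le h \\ \text{distinct}}} \mathfrak S(\{h_1, \dots, h_k\}), \] the sum running over ordered $k$-tuples of distinct positive integers $h_1,\dots,h_k\le h$. Then \[ T_k(h) \ll h^k \prod_{p \le k^3} \frac 1{(1-1/p)^k} \ll h^k (3\log k)^k, \] with absolute implied constants.
   Context: For a finite set $\mathcal H = \{h_1,\dots,h_k\}$ of $k$ distinct integers, $\nu_{\mathcal H}(p)$ denotes the number of distinct residue classes modulo the prime $p$ occupied by the elements of $\mathcal H$, and the singular series is \[ \mathfrak S(\mathcal H) = \prod_{p \text{ prime}} \frac{1-\nu_{\mathcal H}(p)/p}{(1-1/p)^k}. \] Products over $p$ are over primes.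
   Formalization: The second link of the chain is false (by Mertens the product is ((e^γ+o(1))·3 log k)^k), so it is dropped; both upper bounds are proved directly for T_k(h), and the bound h^k(3 log k)^k is stated for k ≥ 2, since at k = 1 it would read h ≪ 0. *)

(* Defs.v *)
From HB Require Import structures.
From mathcomp Require Import all_boot all_order all_algebra finmap.
From mathcomp Require Import all_classical all_reals all_analysis.

Set Implicit Arguments.
Unset Strict Implicit.
Unset Printing Implicit Defensive.

Import Order.TTheory GRing.Theory Num.Theory.
Import numFieldNormedType.Exports.

Local Open Scope ring_scope.
Local Open Scope classical_set_scope.

Definition nu (H : {fset int}) (p : nat) : nat :=
  #|` [fset modz x p%:Z | x in H]%fset |.

Definition singular_factor (R : realType) (H : {fset int}) (p : nat) : R :=
  (1 - (nu H p)%:R / p%:R) / (1 - 1 / p%:R) ^+ #|` H|.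

(* The factors are 1 + O(1/p^2), so the partial products over p < n converge
   for every finite H and [lim] is never the junk value. *)
Definition singular_series (R : realType) (H : {fset int}) : R :=
  lim ((fun n : nat => \prod_(0 <= p < n | prime p) singular_factor R H p)
         @ \oo).

(* Tuples (h_1, ..., h_k) of distinct integers in [1, h]: 'I_h.+1 is [0, h],
   and 0 is excluded. *)
Definition Tsum (R : realType) (k h : nat) : R :=
  \sum_(f : {ffun 'I_k -> 'I_h.+1} |
          injectiveb f && [forall i : 'I_k, (0 < f i)%N])
     singular_series R [fset Posz (f i) | i in 'I_k]%fset.

(* Main.v *)
Require Import Defs.
From mathcomp Require Import all_boot all_order all_algebra finmap.
From mathcomp Require Import all_classical all_reals all_analysis.
From mathcomp Require Import zify ring lra.

Set Implicit Arguments.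
Unset Strict Implicit.
Unset Printing Implicit Defensive.

Import Order.TTheory GRing.Theory Num.Theory.
Import numFieldNormedType.Exports.

Local Open Scope ring_scope.

(** Let [a_p = 1 - 1/p].  The factor of the singular series at [p] is at most
    [a_p ^ (-k)], and also at most [a_p ^ (-M_p)], where [M_p] counts the pairs
    [j < i] with [h_i = h_j mod p]: this is Bernoulli's inequality
    [1 - nu/p <= a_p ^ nu] together with [nu >= k - M_p].  The first bound is
    used for [p <= k^3], the second one for [p > k^3].  By AM-GM over the [k^2]
    ordered pairs, the product of the large factors is at most the mean over
    [(i, j)] of the multiplicative function [\prod_(p > k^3, p | h_i - h_j)
    a_p ^ (- k^2)], whose average over the integers up to [h] is bounded
    because [k^2 * \sum_(p > k^3) 1 / p^2] is.

    To gain a factor [(phi(P) / P) ^ k] for a fixed [P], note that a nonzero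
    singular series forces the tuple to miss a class modulo every prime, so by
    the Chinese remainder theorem all [h_i + n] are coprime to [P] for some
    [n < P]; at most [(phi(P) / P) (h + P)] integers up to [h] qualify, and
    [(1 + P/h) ^ k <= e^P] since [k <= h] unless the sum is empty.  Taking
    [P = 1] gives the first bound.  For the second one, the product over
    [p <= k^3] is only known (and needed) to be at most [(M ln (k^3)) ^ k] for
    some [M], its true order being [(3 e^gamma ln k) ^ k]: the constant [M] is
    absorbed by a [P] with [phi(P) / P <= 1 / M]. *)

(** * Upper bound in Mertens' theorem *)

Definition primorial (z : nat) : nat := (\prod_(0 <= p < z | prime p) p)%N.

Lemma coprime_prod_prime_pow (e : nat -> nat) (n : nat) : prime n ->
  coprime (\prod_(0 <= p < n | prime p) p ^ e p)%N n.
Proof.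
move=> prn; rewrite big_seq_cond.
apply: (big_ind (fun x => coprime x n)) => [|x y cx cy|p].
- by rewrite coprime1n.
- by rewrite coprimeMl cx.
- rewrite mem_index_iota => /andP[/andP[_ lt_pn] prp].
  by rewrite coprimeXl// prime_coprime// dvdn_prime2// neq_ltn lt_pn.
Qed.

(** Powers of distinct primes are coprime, so divisibility can be checked one prime at a time. It is
    applied below to a central binomial coefficient and to a factorial. *)
Lemma prod_prime_pow_dvdn (e : nat -> nat) (n N : nat) :
  (forall p, prime p -> (p < n)%N -> p ^ e p %| N)%N ->
  (\prod_(0 <= p < n | prime p) p ^ e p %| N)%N.
Proof.
elim: n => [|n IHn] dvdN; first by rewrite big_geq.
have {}IHn : (\prod_(0 <= p < n | prime p) p ^ e p %| N)%N.
  by apply: IHn => p prp lt_pn; apply: dvdN => //; apply: ltnW.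
rewrite big_mkcond big_nat_recr//= -big_mkcond /=.
case: ifPn => [prn|_]; last by rewrite muln1.
rewrite Gauss_dvd ?IHn ?dvdN//; apply: coprimeXr.
exact: coprime_prod_prime_pow.
Qed.

Lemma leq_bin_exp2 (n m : nat) : ('C(n, m) <= 2 ^ n)%N.
Proof.
have [le_mn|lt_nm] := leqP m n; last by rewrite bin_small.
rewrite -[2%N]/(1 + 1)%N expnDn.
have ltm : (m < n.+1)%N by rewrite ltnS.
rewrite (bigD1 (Ordinal ltm)) //= !exp1n !muln1; exact: leq_addr.
Qed.

(** Chebyshev's argument: a prime in [(m, 2m]] divides [(2m)!] but not [m!], hence divides
    ['C(2m, m)], which is at most [4 ^ m]. *)
Lemma primorial_doubling (m : nat) :
  (primorial m.*2.+1 <= primorial m.+1 * 4 ^ m)%N.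
Proof.
rewrite /primorial.
have le_m : (m <= m.*2)%N by rewrite -addnn leq_addr.
rewrite (@big_cat_nat _ _ _ m.+1)//=.
rewrite leq_mul2l; apply/orP; right.
(* The boolean exponent [m < p] selects the primes above [m]. *)
have dvd : (\prod_(0 <= p < m.*2.+1 | prime p) p ^ (m < p) %| 'C(m.*2, m))%N.
  apply: prod_prime_pow_dvdn => p prp; rewrite ltnS => le_p.
  have [lt_mp|_] := ltnP m p; last by rewrite dvd1n.
  have : (p %| m.*2 `!)%N by rewrite dvdn_fact// prime_gt0.
  have ndvd : ~~ (p %| m`!)%N.
    rewrite fact_prod big_seq_cond; apply: (big_ind (fun x => ~~ (p %| x)%N)).
    - by rewrite dvdn1 neq_ltn prime_gt1 ?orbT.
    - by move=> x y nx ny; rewrite Euclid_dvdM// negb_or nx.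
    - move=> i; rewrite mem_index_iota andbT => /andP[i0 le_im].
      by rewrite gtnNdvd// (leq_ltn_trans _ lt_mp).
  rewrite -(bin_fact le_m) -addnn addnK expn1 !Euclid_dvdM//.
  by rewrite (negbTE ndvd) !orbF.
rewrite -[4%N]/(2 ^ 2)%N -expnM mul2n.
apply: leq_trans (leq_bin_exp2 m.*2 m); apply: dvdn_leq; first by rewrite bin_gt0.
apply: dvdn_trans dvd.
rewrite [X in (_ %| X)%N](@big_cat_nat _ _ _ m.+1)//=.
rewrite dvdn_mull// [X in (_ %| X)%N]big_nat_cond [X in (X %| _)%N]big_nat_cond.
under [X in (_ %| X)%N]eq_bigr => p /andP[/andP[-> _] _].
  by rewrite expn1; over.
exact: dvdnn.
Qed.

(* Doubling gives [primorial n.+1 <= 16 ^ m * 4 ^ m = 8 ^ m.*2] with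
   [m.*2 <= n.+1], which is enough from [n = 3] on. *)
Lemma primorial_le (n : nat) : (primorial n.+1 <= 16 ^ n)%N.
Proof.
elim/ltn_ind: n => n IHn.
have [n3|n3] := leqP 3 n; last first.
  by move: n n3 {IHn}; do 3?[case => //]; rewrite /primorial /index_iota unlock.
pose m := uphalf n.
have le_mn : (m < n)%N by rewrite /m; lia.
have le_n : (n <= m.*2)%N by rewrite /m; lia.
have le_n' : (m.*2 <= n.+1)%N by rewrite /m; lia.
apply: (@leq_trans (primorial m.*2.+1)).
  rewrite /primorial [X in (_ <= X)%N](@big_cat_nat _ _ _ n.+1)//=.
  rewrite leq_pmulr// prodn_cond_gt0// => p; exact: prime_gt0.
apply: leq_trans (primorial_doubling m) _.
apply: (@leq_trans (16 ^ m * 4 ^ m)%N); first by rewrite leq_mul2r IHn ?orbT.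
rewrite -expnMn -[(16 * 4)%N]/(8 ^ 2)%N -expnM mul2n.
apply: (@leq_trans (8 ^ n.+1)%N); first by rewrite leq_exp2l.
rewrite expnS -[16%N]/(8 * 2)%N expnMn mulnC leq_mul2l.
by rewrite -[8%N]/(2 ^ 3)%N leq_exp2l// n3 orbT.
Qed.

(** [n %/ p] is the first term of Legendre's formula for the exponent of [p] in [n!]. *)
Lemma prod_prime_pow_dvd_fact (n : nat) :
  (\prod_(0 <= p < n.+1 | prime p) p ^ (n %/ p) %| n`!)%N.
Proof.
apply: prod_prime_pow_dvdn => p prp; rewrite ltnS => le_pn.
rewrite pfactor_dvdn ?fact_gt0// logn_fact//.
have n_gt0 : (0 < n)%N by rewrite (leq_trans _ le_pn)// prime_gt0.
by rewrite big_ltn// expn1 leq_addr.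
Qed.

Lemma leq_fact_exp (n : nat) : (n`! <= n ^ n)%N.
Proof.
rewrite fact_prod big_add1 big_mkord /=.
have -> : (n ^ n = \prod_(i < n) n)%N by rewrite prod_nat_const card_ord.
by apply: leq_prod => i _.
Qed.

(** Upper half of Mertens' first theorem, multiplied by [n]: [n / p] is at most [n %/ p + 1]. The
    integer parts contribute at most [ln n! <= n ln n], and the ones contribute the logarithm of a
    primorial, at most [n ln 16]. *)
Lemma sum_ln_div_le (R : realType) (n : nat) : (0 < n)%N ->
  \sum_(0 <= p < n.+1 | prime p) ln p%:R / p%:R <= ln n%:R + ln 16 :> R.
Proof.
move=> n_gt0.
have n_gt0R : (0 : R) < n%:R by rewrite ltr0n.
have prod_gt0 (e : nat -> nat) : (0 < \prod_(0 <= p < n.+1 | prime p) p ^ e p)%N.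
  by rewrite prodn_cond_gt0// => p prp; rewrite expn_gt0 prime_gt0.
have ln_prod (e : nat -> nat) :
    ln ((\prod_(0 <= p < n.+1 | prime p) p ^ e p)%N%:R : R) =
    \sum_(0 <= p < n.+1 | prime p) (e p)%:R * ln p%:R.
  elim: n.+1 => [|m IHm]; first by rewrite !big_geq// ln1.
  rewrite [in LHS]big_mkcond [in RHS]big_mkcond !big_nat_recr//= -!big_mkcond /=.
  case: ifPn => [prm|_]; last by rewrite muln1 addr0.
  rewrite natrM lnM ?posrE ?ltr0n ?expn_gt0 ?(prime_gt0 prm)//; last first.
    by rewrite prodn_cond_gt0// => p prp; rewrite expn_gt0 prime_gt0.
  by rewrite IHm natrX lnXn ?ltr0n ?prime_gt0// mulr_natl.
have fact_bound : \sum_(0 <= p < n.+1 | prime p) (n %/ p)%:R * ln p%:R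
    <= n%:R * ln n%:R :> R.
  rewrite -ln_prod [leRHS]mulr_natl -lnXn// -natrX.
  rewrite ler_ln ?posrE ?ltr0n ?expn_gt0 ?n_gt0// ler_nat.
  apply: leq_trans (leq_fact_exp n).
  exact: dvdn_leq (fact_gt0 n) (prod_prime_pow_dvd_fact n).
have theta_bound : \sum_(0 <= p < n.+1 | prime p) ln p%:R <= n%:R * ln 16 :> R.
  rewrite (eq_bigr (fun p => (1%N)%:R * ln p%:R)); last by move=> p _; rewrite mul1r.
  rewrite -(ln_prod (fun=> 1%N)) mulr_natl -lnXn// -natrX.
  rewrite ler_ln ?posrE ?ltr0n ?expn_gt0// ?prod_gt0// ler_nat.
  apply: leq_trans (primorial_le n).
  by under eq_bigr do rewrite expn1.
rewrite -(ler_pM2l n_gt0R) mulrDr mulr_sumr.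
apply: le_trans (lerD fact_bound theta_bound).
rewrite -big_split /=; apply: ler_sum => p prp.
have p_gt0 : (0 : R) < p%:R by rewrite ltr0n prime_gt0.
have -> : (n %/ p)%:R * ln p%:R + ln p%:R = (n %/ p).+1%:R * ln p%:R :> R.
  by rewrite -natr1 mulrDl mul1r.
rewrite mulrCA mulrC ler_wpM2r ?ln_ge0 ?ler1n ?prime_gt0//.
by rewrite ler_pdivrMr// -natrM ler_nat ltnW// -ltn_divLR ?prime_gt0.
Qed.

(* Partial summation: [1 / p = (A p - A p.-1) / ln p], so that the boundary term
   [A n / ln n] is the invariant to carry through the induction. *)
Lemma sum_inv_primes_le (R : realType) (n : nat) : (2 <= n)%N ->
  \sum_(0 <= p < n.+1 | prime p) 1 / p%:R <=
  ln (ln n%:R) - ln (ln 2) + 1 + ln 16 / ln 2 :> R.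
Proof.
move=> n2; pose A m : R := \sum_(0 <= p < m.+1 | prime p) ln p%:R / p%:R.
have ln_gt0n m : (2 <= m)%N -> 0 < ln (m%:R : R) by move=> m2; rewrite ln_gt0// ltr1n.
have AS m : A m.+1 = A m + (if prime m.+1 then ln m.+1%:R / m.+1%:R else 0).
  by rewrite /A big_mkcond big_nat_recr//= -big_mkcond.
suff: \sum_(0 <= p < n.+1 | prime p) 1 / p%:R <= A n / ln n%:R
    + ln (ln n%:R) - ln (ln 2) + ln 16 * (1 / ln 2 - 1 / ln n%:R).
  move=> /le_trans; apply.
  have lnn := ln_gt0n n n2.
  have : A n / ln n%:R <= 1 + ln 16 / ln n%:R.
    have -> : 1 + ln 16 / ln n%:R = (ln n%:R + ln 16) / ln n%:R :> R.
      by rewrite mulrDl divff ?gt_eqF.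
    rewrite ler_wpM2r ?invr_ge0 ?(ltW lnn)//.
    by apply: sum_ln_div_le; rewrite ltnW.
  by move=> ?; lra.
elim: n n2 => // n IHn; rewrite leq_eqVlt => /orP[/eqP <-|n2].
  rewrite /A /index_iota /= !big_cons !big_nil /= !addr0.
  have l2 := ln_gt0n 2%N isT.
  by rewrite mulrAC divff ?gt_eqF// subrr mulr0; lra.
have {}IHn := IHn n2.
rewrite big_mkcond big_nat_recr//= -big_mkcond /=.
have ln_n := ln_gt0n n n2.
have ln_n1 := ln_gt0n n.+1 (ltnW n2).
have A_le : A n <= ln n%:R + ln 16 by apply: sum_ln_div_le; rewrite ltnW.
have step : (if prime n.+1 then 1 / n.+1%:R else 0) =
    A n.+1 / ln n.+1%:R - A n / ln n.+1%:R.
  rewrite AS -mulrBl addrAC subrr add0r; case: ifP => _; last by rewrite mul0r.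
  by rewrite mulrAC divff ?gt_eqF.
have mono : 0 <= 1 / ln n%:R - 1 / ln n.+1%:R :> R.
  rewrite subr_ge0 !div1r lef_pV2 ?posrE// ler_ln ?posrE ?ltr0n ?ler_nat//.
  exact: ltnW.
(* This is [ln t <= t - 1] at [t = ln n / ln n.+1]; it builds up the double logarithm. *)
have tel : 1 - ln n%:R / ln n.+1%:R <= ln (ln n.+1%:R) - ln (ln n%:R) :> R.
  rewrite -[X in _ <= X]opprB -ln_div ?posrE// lerNr opprB.
  set t := _ / _; have t_gt0 : 0 < t by rewrite divr_gt0.
  have := @le_ln1Dx R (t - 1); rewrite addrCA subrr addr0; apply; lra.
(* The bound on [A n] is weighted by the decrease of [1 / ln]: its [ln n] part is handled by [tel],
   and its [ln 16] part telescopes into the last term of the invariant. *)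
have key : 0 <= (ln 16 + ln n%:R - A n) * (1 / ln n%:R - 1 / ln n.+1%:R).
  by rewrite mulr_ge0//; lra.
have e1 : ln n%:R * (1 / ln n%:R - 1 / ln n.+1%:R) = 1 - ln n%:R / ln n.+1%:R :> R.
  by rewrite mulrBr !mul1r divff ?gt_eqF.
have : \sum_(0 <= i < n.+1 | prime i) 1 / i%:R + 
  (A n.+1 / ln n.+1%:R - A n / ln n.+1%:R) <= A n.+1 / ln n.+1%:R +
  ln (ln n.+1%:R) - ln (ln 2) + ln 16 * (1 / ln 2 - 1 / ln n.+1%:R).
  move: IHn tel key; rewrite [(_ + _ - A n) * _]mulrBl [(_ + ln n%:R) * _]mulrDl e1.
  lra.
by rewrite step.
Qed.

(** Over all integers [p > m] the sum telescopes, as [1 / (p (p - 1)) = 1 / (p - 1) - 1 / p]. *)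
Lemma sum_inv_mul_pred_le (R : realType) (m n : nat) : (0 < m)%N ->
  \sum_(m.+1 <= p < n | prime p) 1 / (p%:R * (p%:R - 1)) <= 1 / m%:R :> R.
Proof.
move=> m_gt0; have m0 : (0 : R) < m%:R by rewrite ltr0n.
have [nm|mn] := leqP n m.+1; first by rewrite big_geq// div1r invr_ge0 ltW.
apply: (@le_trans _ _ (\sum_(m.+1 <= p < n) (- p%:R^-1 - (- p.-1%:R^-1)))).
  rewrite big_mkcond /= big_nat_cond [leRHS]big_nat_cond.
  apply: ler_sum => p /andP[/andP[mp _] _].
  have p1 : (1 < p)%N by rewrite (leq_trans _ mp).
  have p0 : (0 : R) < p%:R - 1 by rewrite subr_gt0 ltr1n.
  have -> : p.-1%:R = p%:R - 1 :> R by rewrite -subn1 natrB// ltnW.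
  have -> : - p%:R^-1 - - (p%:R - 1)^-1 = 1 / (p%:R * (p%:R - 1)) :> R.
    by field; rewrite gt_eqF//= gt_eqF//; lra.
  case: ifP => // _; apply: divr_ge0 => //; apply: mulr_ge0 => //; lra.
rewrite big_add1 /= (@telescope_sumr R m n.-1 (fun p => - p%:R^-1)); last by lia.
by rewrite opprK div1r gerDr oppr_le0 invr_ge0.
Qed.

Lemma prime_factor_gt0 (R : realType) (p : nat) : prime p -> 0 < 1 - 1 / p%:R :> R.
Proof.
by move=> prp; rewrite subr_gt0 div1r invf_lt1 ?ltr0n ?ltr1n ?prime_gt0 ?prime_gt1.
Qed.

Lemma prime_factor_le1 (R : realType) (p : nat) : 1 - 1 / p%:R <= 1 :> R.
Proof. by rewrite gerBl div1r invr_ge0. Qed.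

(** Both sides are functions of [x = 1 / (p - 1)], and the inequality is [1 + x <= exp x]. *)
Lemma inv_prime_factor_le (R : realType) (p : nat) : prime p ->
  1 / (1 - 1 / p%:R) <= expR (1 / p%:R + 1 / (p%:R * (p%:R - 1))) :> R.
Proof.
move=> prp; have p1 : (1 : R) < p%:R by rewrite ltr1n prime_gt1.
have -> : 1 / p%:R + 1 / (p%:R * (p%:R - 1)) = 1 / (p%:R - 1) :> R.
  by field; rewrite !gt_eqF//; lra.
have -> : 1 / (1 - 1 / p%:R) = 1 + 1 / (p%:R - 1) :> R.
  by field; rewrite !gt_eqF//; lra.
exact: expR_ge1Dx.
Qed.

Lemma mertens_upper (R : realType) : exists2 C : R, 0 < C & forall n, (2 <= n)%N ->
  \prod_(0 <= p < n.+1 | prime p) (1 / (1 - 1 / p%:R)) <= C * ln n%:R.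
Proof.
(* The first [1] bounds the sum of [1 / (p (p - 1))]; the rest is the constant of
   [sum_inv_primes_le]. *)
exists (expR (1 - ln (ln 2) + 1 + ln 16 / ln 2)); first exact: expR_gt0.
move=> n n2; have lnn : 0 < ln (n%:R : R) by rewrite ln_gt0// ltr1n.
rewrite -[X in _ * X]lnK ?posrE// -expRD.
apply: (@le_trans _ _ (\prod_(0 <= p < n.+1 | prime p)
    expR (1 / p%:R + 1 / (p%:R * (p%:R - 1))))).
  apply: ler_prod => p prp; rewrite inv_prime_factor_le// andbT.
  by rewrite divr_ge0// ltW// prime_factor_gt0.
rewrite -expR_sum ler_expR big_split /=.
have := @sum_inv_primes_le R n n2.
have := @sum_inv_mul_pred_le R 1 n.+1 isT.
have -> : \sum_(2 <= p < n.+1 | prime p) 1 / (p%:R * (p%:R - 1)) =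
  \sum_(0 <= p < n.+1 | prime p) 1 / (p%:R * (p%:R - 1)) :> R.
  by rewrite [RHS]big_mkcond big_ltn// big_ltn 1?ltnW//= !add0r -big_mkcond.
lra.
Qed.

(** * Integers [P] with small [totient P / P] *)

Lemma sum_dvdn_mul (V : nmodType) (F : nat -> V) (p N : nat) : (0 < p)%N ->
  \sum_(1 <= n < N.+1 | (p %| n)%N) F n = \sum_(1 <= m < (N %/ p).+1) F (p * m)%N.
Proof.
move=> p_gt0; elim: N => [|N IHN]; first by rewrite div0n !big_geq.
rewrite big_mkcond big_nat_recr//= -big_mkcond IHN divnS//.
case: (boolP (p %| N.+1)%N) => [dvd|_]; last by rewrite addr0 add0n.
rewrite add1n [RHS]big_nat_recr//=; congr (_ + F _).
by rewrite -[LHS](divnK dvd) divnS// dvd add1n mulnC.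
Qed.

Lemma harmonic_ge_ln (R : realType) (N : nat) :
  ln N.+1%:R <= \sum_(1 <= n < N.+1) 1 / n%:R :> R.
Proof.
elim: N => [|N IHN]; first by rewrite big_geq// ln1.
rewrite big_nat_recr//=; apply: le_trans (lerD IHN (lexx _)).
have N_gt0 : (0 : R) < N.+1%:R by rewrite ltr0n.
have -> : N.+2%:R = N.+1%:R * (1 + 1 / N.+1%:R) :> R.
  by rewrite mulrDr mulr1 div1r divff ?gt_eqF// natr1.
have inv_gt0 : 0 < 1 / N.+1%:R :> R by rewrite divr_gt0.
by rewrite lnM ?posrE ?addr_gt0// lerD2l le_ln1Dx// (lt_trans _ inv_gt0)// oppr_lt0.
Qed.

Lemma primorialS (z : nat) :
  primorial z.+1 = (if prime z then primorial z * z else primorial z)%N.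
Proof.
rewrite /primorial big_mkcond big_nat_recr//= -big_mkcond.
by case: ifP => // _; rewrite muln1.
Qed.

Lemma coprime_primorialr (z : nat) : prime z -> coprime (primorial z) z.
Proof.
move=> prz; have := coprime_prod_prime_pow (fun=> 1%N) prz.
by under eq_bigr do rewrite expn1.
Qed.

Lemma primorial_gt0 (z : nat) : (0 < primorial z)%N.
Proof. by rewrite prodn_cond_gt0// => p; apply: prime_gt0. Qed.

Lemma dvdn_primorial (p z : nat) : prime p -> (p < z)%N -> (p %| primorial z)%N.
Proof.
move=> prp; elim: z => // z IHz; rewrite ltnS leq_eqVlt primorialS.
case/orP => [/eqP <-|/IHz dvd]; first by rewrite prp dvdn_mull.
by case: ifP => // _; rewrite dvdn_mulr.
Qed.

Lemma totient_primorial (R : realType) (z : nat) :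
  (totient (primorial z))%:R / (primorial z)%:R =
  \prod_(0 <= p < z | prime p) (1 - 1 / p%:R) :> R.
Proof.
elim: z => [|z IHz].
  by rewrite /primorial !big_geq// -[totient 1]/1%N divr1.
rewrite [RHS]big_mkcond big_nat_recr//= -big_mkcond primorialS -IHz.
case: ifPn => [prz|_]; last by rewrite mulr1.
have z0 : (z%:R : R) != 0 by rewrite pnatr_eq0 -lt0n prime_gt0.
have P0 : ((primorial z)%:R : R) != 0 by rewrite pnatr_eq0 -lt0n primorial_gt0.
rewrite totient_coprime ?coprime_primorialr// (totient_prime prz).
rewrite -subn1 !natrM natrB ?prime_gt0//.
by field; rewrite z0 P0.
Qed.

(* Sieving the harmonic sum by one more prime [p] removes at most a proportion
   [1 / p] of what is left. *)
Lemma sieved_harmonic_ge (R : realType) (z N : nat) :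
  \prod_(0 <= p < z | prime p) (1 - 1 / p%:R) * \sum_(1 <= n < N.+1) 1 / n%:R <=
  \sum_(1 <= n < N.+1 | coprime n (primorial z)) 1 / n%:R :> R.
Proof.
elim: z => [|z IHz].
  rewrite (big_geq (leqnn 0)) mul1r /primorial (big_geq (leqnn 0)).
  by under [leRHS]eq_bigl do rewrite coprimen1.
rewrite big_mkcond big_nat_recr//= -big_mkcond primorialS.
case: ifPn => [prz|_]; last by rewrite mulr1.
rewrite mulrAC; apply: le_trans.
  by apply: ler_wpM2r IHz; apply/ltW/prime_factor_gt0.
have z0 : (0 : R) < z%:R by rewrite ltr0n prime_gt0.
rewrite mulrBr mulr1 lerBlDr [leLHS](bigID (fun n => z %| n)%N)/= addrC lerD//.
  rewrite le_eqVlt; apply/orP; left; apply/eqP; apply: eq_bigl => n.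
  by rewrite coprimeMr [coprime n z]coprime_sym (prime_coprime _ prz).
(* The removed terms are [n = z * m] with [m <= N %/ z], and [m] is again coprime to the smaller
   primorial. *)
under eq_bigl do rewrite andbC.
rewrite big_mkcondr sum_dvdn_mul ?prime_gt0//= [leRHS]mulrC mulr_sumr.
rewrite [leRHS]big_mkcond [leRHS](@big_cat_nat _ _ _ (N %/ z).+1)//=; last first.
  by rewrite ltnS leq_div.
rewrite -[leLHS]addr0; apply: lerD; last first.
  by apply: sumr_ge0 => n _; case: ifP => // _; rewrite mulr_ge0 ?divr_ge0// ltW.
apply: ler_sum => n _; rewrite coprimeMl; case: (coprime n _); rewrite ?andbF//.
rewrite andbT; case: ifP => _; last by rewrite mulr_ge0 ?divr_ge0// ltW.
by rewrite natrM !div1r invfM.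
Qed.

(** Every integer in [[2, N]] has a prime factor at most [N], so sieving by these primes leaves only
    the term [1]. The sieve inequality then bounds the ratio by the inverse of the harmonic sum,
    which exceeds [1 / e] for large [N]. *)
Lemma totient_ratio_small (R : realType) (e : R) : 0 < e ->
  exists2 P : nat, (0 < P)%N & (totient P)%:R / P%:R <= e.
Proof.
move=> e_gt0; pose N := (Num.truncn (expR (1 / e))).+1.
exists (primorial N.+1); rewrite ?primorial_gt0// totient_primorial.
have lnN : 1 / e <= ln N.+1%:R :> R.
  rewrite -ler_expR lnK ?posrE ?ltr0n//.
  apply: le_trans (ltW (Num.Theory.truncnS_gt _)) _.
  by rewrite ler_nat.
have H_ge := le_trans lnN (harmonic_ge_ln R N).
have H_gt0 : 0 < \sum_(1 <= n < N.+1) 1 / n%:R :> R.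
  by apply: lt_le_trans H_ge; rewrite divr_gt0.
have := sieved_harmonic_ge R N.+1 N.
have -> : \sum_(1 <= n < N.+1 | coprime n (primorial N.+1)) 1 / n%:R = 1 :> R.
  rewrite big_mkcond big_ltn// coprime1n big_nat_cond.
  rewrite big1 /= => [|n]; first by rewrite divr1 addr0.
  rewrite andbT => /andP[n1 nN]; case: ifP => // cop.
  have prp := pdiv_prime n1.
  suff : (pdiv n %| 1)%N by rewrite dvdn1 => /eqP e1; rewrite e1 in prp.
  rewrite -(eqP cop) dvdn_gcd pdiv_dvd /=.
  by apply: dvdn_primorial => //; rewrite (leq_ltn_trans (pdiv_leq _))// ltnW.
move=> /(fun h => le_trans (ler_wpM2l _ H_ge) h) h.
have : \prod_(0 <= p < N.+1 | prime p) (1 - 1 / p%:R) * (1 / e) <= 1 :> R.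
  by apply: h; apply: prodr_ge0 => p prp; apply/ltW/prime_factor_gt0.
by rewrite div1r ler_pdivrMr// mul1r.
Qed.

(** * Local factors of the singular series *)

(** Bernoulli's inequality; each induction step has [n * a ^ 2] to spare. *)
Lemma one_sub_natmul_le (R : realType) (a : R) (n : nat) : 0 <= a <= 1 ->
  1 - n%:R * a <= (1 - a) ^+ n.
Proof.
move=> /andP[a0 a1]; elim: n => [|n IHn]; first by rewrite mul0r subr0.
rewrite exprSr; apply: le_trans (ler_wpM2r _ IHn); last by lra.
rewrite -natr1 -subr_ge0.
have -> : (1 - n%:R * a) * (1 - a) - (1 - (n%:R + 1) * a) = n%:R * (a * a) by ring.
by rewrite !mulr_ge0.
Qed.

Lemma lim_eventually_nonincreasing (R : realType) (u : R^nat) (n0 : nat) :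
  (forall n, 0 <= u n) -> (forall n, (n0 <= n)%N -> u n.+1 <= u n) ->
  0 <= limn u <= u n0.
Proof.
move=> u_ge0 u_dec; pose v n := u (n + n0)%N.
have v_dec : nonincreasing_seq v.
  by apply/nonincreasing_seqP => n; apply: u_dec; rewrite leq_addl.
have v_cvg : cvgn v.
  apply: nonincreasing_is_cvgn v_dec _.
  by exists 0 => _ [n _ <-]; apply: u_ge0.
have u_lim : limn u = limn v.
  by apply: cvg_lim => //; rewrite -(cvg_shiftn n0).
rewrite u_lim; apply/andP; split; first by apply: limr_ge => //; near=> n; apply: u_ge0.
exact: nonincreasing_cvgn_ge v_dec v_cvg 0%N.
Unshelve. all: by end_near. Qed.

Section Tuples.
Variables (R : realType) (k h : nat).
Implicit Types (f : {ffun 'I_k -> 'I_h.+1}) (p : nat).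

Definition tuple_set f : {fset int} := [fset Posz (f i) | i in 'I_k]%fset.

Definition collisions f p : {set 'I_k * 'I_k} :=
  [set ij : 'I_k * 'I_k | (ij.2 < ij.1)%N && (f ij.1 == f ij.2 %[mod p])].

Lemma card_tuple_set f : injective f -> #|` tuple_set f| = k.
Proof.
move=> inj_f; rewrite card_imfset /=; first by rewrite -cardE card_ord.
by move=> i j [] /val_inj/inj_f.
Qed.

Lemma nuE f p : nu (tuple_set f) p = size (undup [seq (f i %% p)%N | i <- enum 'I_k]).
Proof.
rewrite /nu -(size_map Posz); apply: perm_size; apply: uniq_perm.
- exact: fset_uniq.
- by rewrite map_inj_uniq ?undup_uniq// => m n [].
move=> x; apply/imfsetP/mapP => /=.
  move=> [_ /imfsetP[i _ ->] ->]; exists (f i %% p)%N; last by rewrite modz_nat.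
  by rewrite mem_undup; apply/mapP; exists i; rewrite ?mem_enum.
move=> [b]; rewrite mem_undup => /mapP[i _ ->] ->.
by exists (Posz (f i)); rewrite ?modz_nat//; apply/imfsetP; exists i.
Qed.

Lemma nu_le f p : (0 < p)%N -> (nu (tuple_set f) p <= p)%N.
Proof.
move=> p_gt0; rewrite nuE -[leqRHS](size_iota 0); apply: uniq_leq_size.
  exact: undup_uniq.
move=> b; rewrite mem_undup => /mapP[i _ ->].
by rewrite mem_iota add0n ltn_mod.
Qed.

Lemma nu_full f p : (0 < p)%N ->
  (forall b, (b < p)%N -> exists i, (f i %% p)%N = b) -> nu (tuple_set f) p = p.
Proof.
move=> p_gt0 full; apply/eqP; rewrite eqn_leq nu_le//= nuE -[leqLHS](size_iota 0).
apply: uniq_leq_size (iota_uniq _ _) _ => b; rewrite mem_iota add0n /= => /full[i <-].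
by rewrite mem_undup; apply/mapP; exists i; rewrite ?mem_enum.
Qed.

(** Discard the indices that share their class with a smaller index. The remaining ones occupy
    distinct classes, and each discarded index is the first component of some collision. *)
Lemma leq_nu_collisions f p : (k <= nu (tuple_set f) p + #|collisions f p|)%N.
Proof.
pose S := fst @: collisions f p.
rewrite -[leqLHS]card_ord -(cardsC S) addnC; apply: leq_add; last exact: leq_imset_card.
rewrite nuE cardE -(size_map (fun i => f i %% p)%N); apply: uniq_leq_size.
  rewrite map_inj_in_uniq ?enum_uniq// => i j; rewrite !mem_enum !inE => iS jS eq_ij.
  case: (ltngtP i j) => [lt_ij|lt_ji|/val_inj//].
    by case/imsetP: jS; exists (j, i); rewrite // inE lt_ij/= eq_ij.
  by case/imsetP: iS; exists (i, j); rewrite // inE lt_ji/= eq_ij.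
by move=> b /mapP[i _ ->]; rewrite mem_undup; apply/mapP; exists i; rewrite ?mem_enum.
Qed.

Lemma collisions_large f p : injective f -> (h < p)%N -> #|collisions f p| = 0%N.
Proof.
move=> inj_f lt_hp; apply: eq_card0 => -[i j]; rewrite inE /=; apply/negP => /andP[lt_ji].
rewrite !modn_small ?(leq_ltn_trans _ lt_hp) -1?ltnS// => /eqP/val_inj/inj_f e.
by rewrite e ltnn in lt_ji.
Qed.

Lemma singular_factor_ge0 f p : prime p -> 0 <= singular_factor R (tuple_set f) p.
Proof.
move=> prp; have p0 := prime_gt0 prp.
rewrite divr_ge0 ?exprn_ge0 ?(ltW (prime_factor_gt0 _ prp))// subr_ge0.
by rewrite ler_pdivrMr ?ltr0n// mul1r ler_nat nu_le.
Qed.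

Lemma singular_factor_le f p : injective f -> prime p ->
  singular_factor R (tuple_set f) p <= 1 / (1 - 1 / p%:R) ^+ k.
Proof.
move=> inj_f prp; rewrite /singular_factor card_tuple_set//.
rewrite ler_wpM2r ?invr_ge0 ?exprn_ge0 ?(ltW (prime_factor_gt0 _ prp))//.

Qed.

Lemma singular_factor_le_collisions f p : injective f -> prime p ->
  singular_factor R (tuple_set f) p <= (1 / (1 - 1 / p%:R)) ^+ #|collisions f p|.
Proof.
move=> inj_f prp; rewrite /singular_factor card_tuple_set//.
have a_gt0 := prime_factor_gt0 R prp; have a_le1 := prime_factor_le1 R p.
have : 1 - (nu (tuple_set f) p)%:R / p%:R <= (1 - 1 / p%:R) ^+ nu (tuple_set f) p :> R.
  have := @one_sub_natmul_le R (1 / p%:R) (nu (tuple_set f) p).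
  by rewrite [_%:R * (1 / _)]mulrA mulr1; apply; apply/andP; split; lra.
move: (1 - 1 / p%:R) a_gt0 a_le1 => a a_gt0 a_le1 bernoulli.
rewrite ler_pdivrMr ?exprn_gt0// expr_div_n expr1n mulrAC mul1r.
rewrite ler_pdivlMr ?exprn_gt0//.
apply: (@le_trans _ _ (a ^+ (nu (tuple_set f) p + #|collisions f p|))).
  by rewrite exprD ler_wpM2r ?exprn_ge0 ?(ltW a_gt0).
by rewrite ler_wiXn2l ?(ltW a_gt0)// leq_nu_collisions.
Qed.

(** A prime [p >= n0 > h] has no collisions, so its factor is at most 1 and the partial products
    decrease from [n0] on. *)
Lemma singular_series_le f (n0 : nat) : injective f -> (h < n0)%N ->
  0 <= singular_series R (tuple_set f) <=
  \prod_(0 <= p < n0 | prime p) singular_factor R (tuple_set f) p.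
Proof.
move=> inj_f lt_h; apply: lim_eventually_nonincreasing => n.
  by apply: prodr_ge0 => p; apply: singular_factor_ge0.
move=> le_n; rewrite [leLHS]big_mkcond big_nat_recr//= -big_mkcond.
have prod_ge0 : 0 <= \prod_(0 <= p < n | prime p) singular_factor R (tuple_set f) p.
  by apply: prodr_ge0 => p; apply: singular_factor_ge0.
case: ifPn => [prn|_]; last by rewrite mulr1.
rewrite ler_piMr//; apply: le_trans (singular_factor_le_collisions inj_f prn) _.
by rewrite collisions_large// (leq_trans lt_h).
Qed.

(** If every class is occupied, the factor at [p] is zero, and so is any partial product that
    includes it and bounds the series. *)
Lemma singular_series_neq0 f p : injective f -> prime p ->
  singular_series R (tuple_set f) != 0 ->
  exists2 b, (b < p)%N & forall i, (f i %% p)%N != b.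
Proof.
move=> inj_f prp; apply: contra_neqP => full.
have p0 := prime_gt0 prp.
have nu_p : nu (tuple_set f) p = p.
  apply: nu_full => // b lt_bp.
  apply: contra_notP full => no_i; exists b => // i; apply/eqP => e.
  by apply: no_i; exists i.
apply/eqP; rewrite eq_le; apply/andP.
have /andP[ge0 le] := @singular_series_le f (maxn h p).+1 inj_f (leq_maxl _ _).
split=> //; apply: le_trans le _.
rewrite big_mkcond (bigD1_seq p) ?iota_uniq//=; last first.
  by rewrite mem_index_iota ltnS leq_maxr.
by rewrite prp /singular_factor nu_p divff ?pnatr_eq0 -?lt0n// subrr !mul0r.
Qed.

Lemma singular_series_le_large f (y n0 : nat) :
  injective f -> (h < n0)%N -> (y < n0)%N ->
  singular_series R (tuple_set f) <=
  \prod_(0 <= p < y.+1 | prime p) (1 / (1 - 1 / p%:R) ^+ k) *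
  \prod_(y.+1 <= p < n0 | prime p) (1 / (1 - 1 / p%:R)) ^+ #|collisions f p|.
Proof.
move=> inj_f lt_h lt_y.
have /andP[_] := singular_series_le inj_f lt_h; move/le_trans; apply.
rewrite (@big_cat_nat _ _ _ y.+1)//=; apply: ler_pM.
- by apply: prodr_ge0 => p; apply: singular_factor_ge0.
- by apply: prodr_ge0 => p; apply: singular_factor_ge0.
- by apply: ler_prod => p prp; rewrite singular_factor_ge0 ?singular_factor_le.
- by apply: ler_prod => p prp; rewrite singular_factor_ge0 ?singular_factor_le_collisions.
Qed.

End Tuples.

(** * Mean value of the contribution of large primes *)

Section Mean.
Variable R : realType.
Implicit Types (c : nat -> R) (s : seq nat).

(* Expanding [\prod_(p %| d) c p = \prod_(p %| d) (1 + (c p - 1))] one prime at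
   a time; [q] collects the primes already required to divide [d]. *)
Lemma sum_prod_dvdn_le c s (h q : nat) : uniq s ->
  {in s, forall p, prime p} -> {in s, forall p, 1 <= c p} ->
  (0 < q)%N -> {in s, forall p, coprime q p} ->
  \sum_(1 <= d < h.+1 | (q %| d)%N) \prod_(p <- s | (p %| d)%N) c p <=
  h%:R / q%:R * \prod_(p <- s) (1 + (c p - 1) / p%:R).
Proof.
elim: s q => [|p s IHs] q /=.
  move=> _ _ _ q_gt0 _.
  rewrite big_nil mulr1 sum_dvdn_mul//.
  under eq_bigr do rewrite big_nil.
  rewrite sumr_const_nat subSS subn0 ler_pdivlMr ?ltr0n// -natrM ler_nat.
  exact: leq_divM.
move=> /andP[ps us] prs cs q_gt0 cop.
have prp : prime p by apply: prs; rewrite mem_head.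
have cp : 1 <= c p by apply: cs; rewrite mem_head.
have copq : coprime q p by apply: cop; rewrite mem_head.
have sub t : t \in s -> t \in p :: s by rewrite in_cons orbC => ->.
have IHq := IHs q us (fun t ts => prs t (sub t ts)) (fun t ts => cs t (sub t ts))
  q_gt0 (fun t ts => cop t (sub t ts)).
have IHqp : \sum_(1 <= d < h.+1 | (q * p %| d)%N) \prod_(p <- s | (p %| d)%N) c p <=
  h%:R / (q * p)%N%:R * \prod_(p <- s) (1 + (c p - 1) / p%:R).
  apply: IHs => //.
  - by move=> t ts; apply/prs/sub.
  - by move=> t ts; apply/cs/sub.
  - by rewrite muln_gt0 q_gt0 prime_gt0.
  - move=> t ts; rewrite coprimeMl cop ?sub//= prime_coprime//.
    rewrite dvdn_prime2//; last by apply/prs/sub.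
    by apply: contraNneq ps => ->.
have -> : \sum_(1 <= d < h.+1 | (q %| d)%N) \prod_(j <- p :: s | (j %| d)%N) c j =
    \sum_(1 <= d < h.+1 | (q %| d)%N) \prod_(j <- s | (j %| d)%N) c j +
    (c p - 1) * \sum_(1 <= d < h.+1 | (q * p %| d)%N) \prod_(j <- s | (j %| d)%N) c j.
  under [X in (c p - 1) * X]eq_bigl do rewrite Gauss_dvd//.
  rewrite big_mkcondr mulr_sumr -big_split /=; apply: eq_bigr => d _.
  rewrite big_cons; case: ifP => _; first by rewrite mulrBl mul1r addrCA subrr addr0.
  by rewrite mulr0 addr0.
have cp0 : 0 <= c p - 1 by rewrite subr_ge0.
apply: le_trans (lerD IHq (ler_wpM2l cp0 IHqp)) _.
have p0 : (p%:R : R) != 0 by rewrite pnatr_eq0 -lt0n prime_gt0.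
have q0 : (q%:R : R) != 0 by rewrite pnatr_eq0 -lt0n.
rewrite big_cons natrM le_eqVlt; apply/orP; left; apply/eqP.
by field; rewrite p0 q0.
Qed.

Definition primes_in (m n : nat) : seq nat := [seq p <- index_iota m n | prime p].

Lemma primes_inP (m n p : nat) : p \in primes_in m n -> [/\ prime p, (m <= p)%N & (p < n)%N].
Proof. by rewrite mem_filter mem_index_iota => /and3P[]. Qed.

(** The share of one pair with difference [d] in the product over large primes; AM-GM later raises
    it to the power [k * k]. *)
Definition tail_weight (k n d : nat) : R :=
  \prod_(p <- primes_in (k ^ 3).+1 n | (p %| d)%N) (1 / (1 - 1 / p%:R)).

Lemma tail_weight_ge0 (k n d : nat) : 0 <= tail_weight k n d.
Proof.
rewrite /tail_weight big_seq_cond; apply: prodr_ge0 => p /andP[/primes_inP[prp _ _] _].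
by rewrite divr_ge0// ltW// prime_factor_gt0.
Qed.

(** With [x = k ^ 2 / p <= 1 / 2], Bernoulli gives [(1 - 1/p) ^ (k ^ 2) >= 1 - x], whose inverse is
    at most [1 + 2 x]. Dividing the excess [2 x] by [p] leaves [2 k ^ 2 / p ^ 2]. *)
Lemma tail_factor_le (k p : nat) : (0 < k)%N -> prime p -> (k ^ 3 < p)%N ->
  1 + ((1 / (1 - 1 / p%:R)) ^+ (k * k) - 1) / p%:R <=
  expR ((k * k).*2%:R * (1 / (p%:R * (p%:R - 1)))) :> R.
Proof.
move=> k_gt0 prp lt_p; apply: le_trans (expR_ge1Dx _); rewrite lerD2l.
have p1 : (1 : R) < p%:R by rewrite ltr1n prime_gt1.
have p0 : (0 : R) < p%:R by lra.
have a_gt0 := prime_factor_gt0 R prp.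
set N : R := (k * k)%:R.
have N0 : 0 <= N by rewrite ler0n.
(* For [k >= 2] this follows from [k ^ 3 < p]; for [k = 1] it says that a prime is at least 2. *)
have N_le : 2 * N <= p%:R.
  rewrite -natrM ler_nat; case: k k_gt0 lt_p {N N0} => // -[|k] _ lt_p.
    exact: prime_gt1.
  by apply: leq_trans (ltnW lt_p); rewrite mulnn [leqRHS]expnS leq_mul2r.
have bern : 1 - N / p%:R <= (1 - 1 / p%:R) ^+ (k * k).
  have := @one_sub_natmul_le R (1 / p%:R) (k * k).
  rewrite [_%:R * (1 / _)]mulrA mulr1; apply.
  by apply/andP; split; [rewrite divr_ge0// ltW|lra].
have x_le : N / p%:R <= 1 / 2 by rewrite ler_pdivrMr//; lra.
have x_ge : 0 <= N / p%:R by rewrite divr_ge0// ltW.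
have c_le : (1 / (1 - 1 / p%:R)) ^+ (k * k) - 1 <= 2 * (N / p%:R).
  rewrite lerBlDr expr_div_n expr1n ler_pdivrMr ?exprn_gt0//.
  move: bern x_le x_ge; set x := N / _; set b := _ ^+ _ => bern x_le x_ge.
  (* The left side equals [1 + x (1 - 2 x)], which is at least 1. *)
  have : (2 * x + 1) * (1 - x) <= (2 * x + 1) * b by apply: ler_wpM2l => //; lra.
  apply: le_trans; nra.
apply: (@le_trans _ _ (2 * (N / p%:R) / p%:R)).
  by rewrite ler_wpM2r ?invr_ge0 ?(ltW p0).
rewrite -mul2n natrM -/N -!mulrA ler_wpM2l// ler_wpM2l// mul1r -invfM.
by rewrite lef_pV2 ?posrE ?mulr_gt0 ?subr_gt0// ler_wpM2l ?(ltW p0)// gerBl.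
Qed.

(** The mean value bound at [q = 1] leaves a product at most the exponential of [2 k ^ 2] times a
    tail sum bounded by [1 / k ^ 3], so the exponent is at most 2. *)
Lemma sum_tail_weight_le (k n h : nat) : (0 < k)%N ->
  \sum_(1 <= d < h.+1) tail_weight k n d ^+ (k * k) <= h%:R * expR 2.
Proof.
move=> k_gt0; pose c p : R := (1 / (1 - 1 / p%:R)) ^+ (k * k).
have c_ge1 : {in primes_in (k ^ 3).+1 n, forall p, 1 <= c p}.
  move=> p /primes_inP[prp _ _]; rewrite /c exprn_ege1//.
  by rewrite ler_pdivlMr ?prime_factor_gt0// mul1r prime_factor_le1.
have := @sum_prod_dvdn_le c (primes_in (k ^ 3).+1 n) h 1
  (filter_uniq _ (iota_uniq _ _)) _ c_ge1 isT _.
rewrite divr1 /tail_weight => mean.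
under eq_bigr do rewrite -prodrXl.
apply: le_trans.
  rewrite (eq_bigl (fun d => 1 %| d)%N) => [|d]; last by rewrite dvd1n.
  apply: mean => p; first by case/primes_inP.
  by rewrite coprime1n.
rewrite ler_wpM2l//.
apply: (@le_trans _ _ (\prod_(p <- primes_in (k ^ 3).+1 n)
    expR ((k * k).*2%:R * (1 / (p%:R * (p%:R - 1)))))).
  rewrite !big_seq; apply: ler_prod => p ps.
  have /primes_inP[prp lt_p _] := ps; rewrite tail_factor_le// andbT.
  by rewrite addr_ge0// divr_ge0// subr_ge0 c_ge1.
rewrite -expR_sum ler_expR -mulr_sumr /primes_in big_filter.
have k3 : (0 < k ^ 3)%N by rewrite expn_gt0 k_gt0.
apply: le_trans (ler_wpM2l _ (sum_inv_mul_pred_le R n k3)) _ => //.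
rewrite div1r ler_pdivrMr ?ltr0n// -natrM ler_nat -muln2 mulnC leq_mul2l/=.
by rewrite expnS expnS expn1 mulnA leq_pmulr.
Qed.

(** Subtraction is truncated, so one summand vanishes and this is [|x - y|]. *)
Definition dist (x y : nat) : nat := (x - y + (y - x))%N.

(** Each distance occurs at most once on either side of [y]. *)
Lemma sum_dist_le (F : nat -> R) (h y : nat) : (forall d, 0 <= F d) -> (y <= h)%N ->
  \sum_(0 <= x < h.+1 | x != y) F (dist x y) <= 2 * \sum_(1 <= d < h.+1) F d.
Proof.
move=> F_ge0 le_yh.
have trunc m : (m <= h.+1)%N -> \sum_(1 <= d < m) F d <= \sum_(1 <= d < h.+1) F d.
  case: m => [|m] le_m; first by rewrite big_geq// sumr_ge0.
  by rewrite [leRHS](@big_cat_nat _ _ _ m.+1)//= lerDl sumr_ge0.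
rewrite (@big_cat_nat _ _ _ y)//=; last exact: leqW.
rewrite [X in _ + X]big_mkcond [X in _ + X]big_ltn//= eqxx /= add0r -big_mkcond /=.
rewrite mulr_natl mulr2n; apply: lerD.
  apply: le_trans (trunc y.+1 _); last by [].
  rewrite big_add1 big_nat_rev /= big_mkcond /= !big_mkord; apply: ler_sum => i _.
  have -> : dist (0 + y - i.+1) y = i.+1 by rewrite /dist; have := ltn_ord i; lia.
  by case: ifP.
apply: le_trans (trunc (h.+1 - y)%N _); last by rewrite leq_subr.
rewrite -[y.+1]add1n big_addn big_mkcond /=; apply: ler_sum => i _.
have -> : dist (i + y) y = i by rewrite /dist; lia.
by case: ifP.
Qed.

Lemma eqn_mod_dist (p x y : nat) : (x == y %[mod p]) = (p %| dist x y)%N.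
Proof.
rewrite /dist; have [le_xy|/ltnW le_yx] := leqP x y.
  by rewrite eq_sym eqn_mod_dvd// (eqP le_xy).
by rewrite eqn_mod_dvd// (eqP le_yx) addn0.
Qed.

(** Exchanging the products over primes and over pairs gives one [tail_weight] per pair. The pairs
    with [i <= j] enter with weight 1, which makes the number of terms exactly [k ^ 2]. *)
Lemma tail_prod_le_mean (k h n : nat) (f : {ffun 'I_k -> 'I_h.+1}) : (0 < k)%N ->
  \prod_((k ^ 3).+1 <= p < n | prime p) (1 / (1 - 1 / p%:R)) ^+ #|collisions f p| <=
  (\sum_(ij : 'I_k * 'I_k) if (ij.2 < ij.1)%N
     then tail_weight k n (dist (f ij.1) (f ij.2)) ^+ (k * k) else 1) / (k * k)%:R.
Proof.
move=> k_gt0.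
pose E (ij : 'I_k * 'I_k) : R :=
  if (ij.2 < ij.1)%N then tail_weight k n (dist (f ij.1) (f ij.2)) else 1.
have E_ge0 ij : 0 <= E ij by rewrite /E; case: ifP => // _; apply: tail_weight_ge0.
have -> : \prod_((k ^ 3).+1 <= p < n | prime p) (1 / (1 - 1 / p%:R)) ^+ #|collisions f p| =
    \prod_ij E ij.
  rewrite -big_filter -/(primes_in _ _).
  transitivity (\prod_(p <- primes_in (k ^ 3).+1 n) \prod_(ij : 'I_k * 'I_k)
    (if ij \in collisions f p then 1 / (1 - 1 / p%:R) else 1 : R)).
    by apply: eq_bigr => p _; rewrite -big_mkcond prodr_const.
  rewrite exchange_big; apply: eq_bigr => ij _; rewrite /E /tail_weight.
  case: ifPn => [lt_ji|nlt]; last by rewrite big1// => p _; rewrite inE (negbTE nlt).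
  by rewrite [RHS]big_mkcond; apply: eq_bigr => p _; rewrite inE lt_ji/= eqn_mod_dist.
have kk : (0 < k * k)%N by rewrite muln_gt0 k_gt0.
have card_kk : #|{: 'I_k * 'I_k}| = (k * k)%N by rewrite card_prod card_ord.
(* AM-GM is applied to the powers [E ij ^+ (k * k)], so that their geometric mean is the product of
   the [E ij]; the comparison is made after raising to the power [k * k]. *)
have := @leif_AGM R _ [pred _ : 'I_k * 'I_k | true] (fun ij => E ij ^+ (k * k))
  (fun ij _ => exprn_ge0 _ (E_ge0 ij)).
rewrite /= -/(#|{: 'I_k * 'I_k}|) card_kk => -[agm _].
have -> : \sum_(ij : 'I_k * 'I_k) (if (ij.2 < ij.1)%N
     then tail_weight k n (dist (f ij.1) (f ij.2)) ^+ (k * k) else 1) =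
     \sum_ij E ij ^+ (k * k).
  by apply: eq_bigr => ij _; rewrite /E; case: ifP => // _; rewrite expr1n.
rewrite -(@ler_pXn2r _ (k * k)) ?nnegrE//.
- by rewrite -prodrXl.
- by apply: prodr_ge0.
- by rewrite divr_ge0// sumr_ge0// => ij _; rewrite exprn_ge0.
Qed.

End Mean.

(** * Tuples avoiding a residue class modulo each prime divisor of [P] *)

Section Sieve.
Local Open Scope nat_scope.

(** Sliding the window by one replaces [c] by [c + P], in the same class modulo [P]. *)
Lemma sum_coprime_window (P c : nat) :
  \sum_(c <= m < c + P) coprime P m = totient P.
Proof.
case: P => [|P]; first by rewrite addn0 big_geq.
elim: c => [|c IHc]; first by rewrite add0n totient_count_coprime.
have le_c : c.+1 <= c + P.+1 by rewrite addnS ltnS leq_addr.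
rewrite -IHc addSn big_nat_recr//= [RHS]big_ltn//.
by rewrite addnC -[coprime _ (c + _)]coprime_modr modnDr coprime_modr.
Qed.

Lemma sum_coprime_windows (P c q : nat) :
  \sum_(c <= m < c + q * P) coprime P m = q * totient P.
Proof.
elim: q => [|q IHq]; first by rewrite mul0n addn0 big_geq.
rewrite (@big_cat_nat _ _ _ (c + q * P))/=; last 2 first.
- exact: leq_addr.
- by rewrite leq_add2l mulSn leq_addl.
rewrite IHq mulSnr addnA sum_coprime_window mulSn; exact: addnC.
Qed.

(** The interval [[n + 1, n + h]] is covered by [h %/ P + 1] windows of length [P]. *)
Lemma card_coprime_translate_le (P h n : nat) : 0 < P ->
  #|[pred x : 'I_h.+1 | (0 < x) && coprime P (x + n)]| <= (h %/ P).+1 * totient P.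
Proof.
move=> P_gt0; rewrite -sum1_card big_mkcond /=.
rewrite (eq_bigr (fun x : 'I_h.+1 => (if 0 < x then (coprime P (x + n) : nat) else 0))); last first.
  by move=> x _; rewrite inE; case: (0 < x); case: coprime.
rewrite -(big_mkord xpredT (fun x => if 0 < x then (coprime P (x + n) : nat) else 0)).
rewrite big_ltn//= add0n.
have -> : \sum_(1 <= x < h.+1) (if 0 < x then (coprime P (x + n) : nat) else 0) =
    \sum_(1 + n <= m < h.+1 + n) coprime P m.
  rewrite [RHS]big_addn addnK; apply: eq_big_nat => x /andP[x1 _].
  by rewrite x1.
rewrite -(sum_coprime_windows P (1 + n)).
rewrite [leqRHS](@big_cat_nat _ _ _ (h.+1 + n))/=; first exact: leq_addr.
- by rewrite leq_add2r.
- by rewrite addSn add1n addSn addnC ltnS leq_add2l ltnW// -ltn_divLR.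
Qed.

Lemma crt_primes (b : nat -> nat) (s : seq nat) : uniq s -> {in s, forall p, prime p} ->
  exists m, {in s, forall p, m = b p %[mod p]}.
Proof.
elim: s => [|p s IHs] /=; first by exists 0.
move=> /andP[ps us] prs.
have sub t : t \in s -> t \in p :: s by rewrite in_cons orbC => ->.
have [m hm] := IHs us (fun t ts => prs t (sub t ts)).
pose M := \prod_(q <- s) q.
have prp : prime p by apply: prs; rewrite mem_head.
have cop : coprime p M.
  rewrite /M big_seq; apply: (big_ind (fun x => coprime p x)) => [|x y cx cy|q qs].
  - exact: coprimen1.
  - by rewrite coprimeMr cx.
  - rewrite prime_coprime// dvdn_prime2//; last by apply/prs/sub.
    by apply: contraNneq ps => ->.
exists (chinese p M (b p) m) => q; rewrite in_cons => /orP[/eqP ->|qs].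
  exact: chinese_modl.
have dvd : q %| M by rewrite /M (big_rem q)//= dvdn_mulr.
by rewrite -(hm q qs) -[LHS](modn_dvdm _ dvd) chinese_modr// modn_dvdm.
Qed.

(** Choose [m] in a missed class modulo each prime divisor of [P], and [n = - m] modulo [P]: a prime
    dividing both [P] and [f i + n] would put [f i] in the missed class. *)
Lemma missed_classes_coprime (I : Type) (P : nat) (f : I -> nat) : 0 < P ->
  (forall p, prime p -> exists2 b, b < p & forall i, f i %% p != b) ->
  exists n : 'I_P, forall i, coprime P (f i + n).
Proof.
move=> P_gt0 miss.
have /choice[b hb] : forall p, exists b, prime p -> b < p /\ forall i, f i %% p != b.
  move=> p; have [prp|_] := boolP (prime p); last by exists 0.
  by have [b ? ?] := miss p prp; exists b.
have [|m hm] := @crt_primes b (primes P) (primes_uniq P).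
  by move=> p; rewrite mem_primes => /andP[].
(* Modulo [P], [m * P.-1] is [- m]. *)
have lt_n : (m * P.-1) %% P < P by rewrite ltn_mod.
exists (Ordinal lt_n) => i /=; rewrite -coprime_modr modnDmr coprime_modr.
rewrite /coprime eqn_leq gcdn_gt0 P_gt0 andbT leqNgt; apply/negP => gcd_gt1.
have prp := pdiv_prime gcd_gt1; set p := pdiv _ in prp.
have dvdP : p %| P by apply: dvdn_trans (pdiv_dvd _) (dvdn_gcdl _ _).
have dvdi : p %| f i + m * P.-1 by apply: dvdn_trans (pdiv_dvd _) (dvdn_gcdr _ _).
have [lt_b /(_ i)/eqP] := hb p prp; apply.
rewrite -[RHS](modn_small lt_b) -(hm p); last by rewrite mem_primes prp P_gt0.
have e : f i + m * P.-1 + m = f i + m * P by rewrite -addnA -mulnSr prednK.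
have : f i + m * P.-1 + m = m %[mod p] by rewrite -modnDml (eqP dvdi).
by rewrite e -modnDmr -modnMmr (eqP dvdP) muln0 mod0n addn0.
Qed.

End Sieve.

(** * Sums over tuples, factored coordinate by coordinate *)

Section SumOverTuples.
Variables (R : realType) (T : finType) (k : nat).

Lemma sum_ffun_all (A : pred T) (B : R) : #|A|%:R <= B ->
  \sum_(f : {ffun 'I_k -> T} | [forall l, A (f l)]) 1 <= B ^+ k.
Proof.
move=> le_B.
have -> : \sum_(f : {ffun 'I_k -> T} | [forall l, A (f l)]) 1 =
  \sum_(f : {ffun 'I_k -> T}) \prod_l (if A (f l) then 1 else 0) :> R.
  rewrite big_mkcond; apply: eq_bigr => f _; case: ifPn => [/forallP Af|].
    by rewrite big1// => l _; rewrite Af.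
  by rewrite negb_forall => /existsP[l nA]; rewrite (bigD1 l)//= (negbTE nA) mul0r.
rewrite -(bigA_distr_bigA (fun (l : 'I_k) x => if A x then 1 else 0 : R)).
rewrite prodr_const card_ord; apply: lerXn2r; rewrite ?nnegrE ?sumr_ge0//.
- by move=> x _; case: ifP.
- exact: le_trans le_B.
- by rewrite -big_mkcond sumr_const.
Qed.

(** Once [y = f j] is fixed, the sum is dominated by one that factors over the coordinates: [1] at
    [j], at most [M] at [i], and at most [B] at each of the other [k - 2]. Membership in [A] is
    given up at [i] and [j]. *)
Lemma sum_ffun_pair (A : pred T) (B M : R) (G : T -> T -> R) (i j : 'I_k) :
  i != j -> #|A|%:R <= B -> (forall x y, 0 <= G x y) ->
  (forall y, \sum_(x | x != y) G x y <= M) ->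
  \sum_(f : {ffun 'I_k -> T} | injectiveb f && [forall l, A (f l)]) G (f i) (f j) <=
  #|T|%:R * (M * B ^+ k.-2).
Proof.
move=> ij le_B G_ge0 le_M.
pose F y (l : 'I_k) x : R := if l == j then (x == y)%:R else
  if l == i then (if x != y then G x y else 0) else (A x)%:R.
have F_ge0 y l x : 0 <= F y l x by rewrite /F; do 3?case: ifP.
apply: (@le_trans _ _ (\sum_y \sum_(f : {ffun 'I_k -> T}) \prod_l F y l (f l))).
  rewrite exchange_big /= big_mkcond /=; apply: ler_sum => f _.
  have prod_ge0 y : 0 <= \prod_l F y l (f l) by apply: prodr_ge0.
  case: ifP => [/andP[/injectiveP inj_f /forallP Af]|_]; last exact: sumr_ge0.
  rewrite (bigD1 (f j))//= -[leLHS]addr0; apply: lerD; last exact: sumr_ge0.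
  rewrite (bigD1 j)//= (bigD1 i)//= /F !eqxx (negbTE ij) mul1r.
  have -> : f i != f j by apply: contraNneq ij => /inj_f ->.
  rewrite big1 ?mulr1// => l /andP[/negbTE -> /negbTE ->].
  by rewrite Af.
have B_ge0 : 0 <= B by apply: le_trans le_B.
rewrite -sum1_card natr_sum mulr_suml; apply: ler_sum => y _; rewrite mul1r.
rewrite -(bigA_distr_bigA (F y)) (bigD1 j)//= (bigD1 i)//=.
have -> : \sum_x F y j x = 1.
  rewrite (bigD1 y)//= /F eqxx eqxx big1 ?addr0// => x /negbTE xy.
  by rewrite xy.
rewrite mul1r; apply: ler_pM; rewrite ?sumr_ge0 ?prodr_ge0//.
- by move=> l _; apply: sumr_ge0.
- by rewrite /F (negbTE ij) eqxx -big_mkcond.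
have -> : B ^+ k.-2 = \prod_(l < k | (l != j) && (l != i)) B.
  rewrite prodr_const; congr (_ ^+ _).
  have -> : #|[pred l : 'I_k | (l != j) && (l != i)]| = #|predC (pred2 j i)|.
    by apply: eq_card => l; rewrite !inE negb_or.
  have e : (2 + #|predC (pred2 j i)| = k)%N.
    by rewrite -[RHS]card_ord -(cardC (pred2 j i)) card2 eq_sym ij.
  by rewrite -[k in LHS]e.
apply: ler_prod => l /andP[/negbTE lj /negbTE li]; rewrite sumr_ge0//=.
apply: le_trans le_B; rewrite /F lj li -sum1_card natr_sum [leRHS]big_mkcond.
by apply: ler_sum => x _; rewrite unfold_in; case: (A x).
Qed.

End SumOverTuples.

(** * Bounds for the sum over tuples *)

(** A union bound over the translates [m < P] costs the factor [P]. In the AM-GM mean, a pair with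
    [i <= j] accounts for the [1], and a pair with [j < i] for [4 * expR 2 * P ^ 2]. *)
Lemma Tsum_le_sieve (R : realType) (k h P : nat) :
  (0 < k)%N -> (k <= h)%N -> (0 < P)%N ->
  Tsum R k h <= P%:R * (1 + 4 * expR 2 * P%:R ^+ 2) *
    ((totient P)%:R / P%:R * (h%:R + P%:R)) ^+ k *
    \prod_(0 <= p < (k ^ 3).+1 | prime p) (1 / (1 - 1 / p%:R) ^+ k).
Proof.
move=> k_gt0 le_kh P_gt0.
set W := \prod_(0 <= p < _ | prime p) _; set B := _ / _ * _.
(* Beyond both [k ^ 3] and [h], so that the product truncated at [n] bounds the series. *)
pose n := (k ^ 3 + h).+1.
have P_gt0R : (0 : R) < P%:R by rewrite ltr0n.
have h_gt0 : (0 < h)%N by apply: leq_trans le_kh.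
pose A (m : nat) := [pred x : 'I_h.+1 | (0 < x)%N && coprime P (x + m)].
pose w (f : {ffun 'I_k -> 'I_h.+1}) (ij : 'I_k * 'I_k) : R := if (ij.2 < ij.1)%N
  then tail_weight R k n (dist (f ij.1) (f ij.2)) ^+ (k * k) else 1.
have w_ge0 f ij : 0 <= w f ij.
  by rewrite /w; case: ifP => // _; rewrite exprn_ge0 ?tail_weight_ge0.
have W_ge0 : 0 <= W.
  apply: prodr_ge0 => p prp.
  by rewrite divr_ge0 ?exprn_ge0 ?(ltW (prime_factor_gt0 _ prp)).
have card_A m : #|A m|%:R <= B.
  apply: (@le_trans _ _ ((h %/ P).+1 * totient P)%N%:R).
    by rewrite ler_nat; apply: card_coprime_translate_le.
  rewrite /B natrM mulrC -mulrA ler_wpM2l// -natr1 mulrDr mulVf ?gt_eqF// lerD2r.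
  by rewrite mulrC ler_pdivlMr// -natrM ler_nat leq_divM.
have B_ge0 : 0 <= B by apply: le_trans (card_A 0%N).
(* From [totient P >= 1]. This pays for the two coordinates of a pair at which the sieve is given
   up. *)
have h_le : h%:R <= P%:R * B.
  rewrite /B mulrA mulrCA divff ?gt_eqF// mulr1.
  apply: (@le_trans _ _ (1 * (h%:R + P%:R))); first by rewrite mul1r lerDl.
  by rewrite ler_wpM2r ?addr_ge0// ler1n totient_gt0.
have kk : (0 : R) < (k * k)%:R by rewrite ltr0n muln_gt0 k_gt0.
have pointwise (f : {ffun 'I_k -> 'I_h.+1}) :
    injectiveb f && [forall i, (0 < f i)%N] ->
    singular_series R (tuple_set f) <=
    \sum_(m < P | [forall l, A m (f l)]) W * ((\sum_ij w f ij) / (k * k)%:R).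
  move=> /andP[/injectiveP inj_f /forallP f_gt0].
  have term_ge0 : 0 <= W * ((\sum_ij w f ij) / (k * k)%:R).
    by rewrite mulr_ge0// divr_ge0 ?sumr_ge0// ltW.
  have [->|S0] := eqVneq (singular_series R (tuple_set f)) 0; first by apply: sumr_ge0.
  have [m cop_m] := @missed_classes_coprime _ P (fun l => f l : nat) P_gt0
    (fun p prp => singular_series_neq0 inj_f prp S0).
  rewrite (bigD1 m)/=; last first.
    by apply/forallP => l; rewrite /= f_gt0 cop_m.
  rewrite -[leLHS]addr0; apply: lerD; last exact: sumr_ge0.
  apply: le_trans (@singular_series_le_large R k h f (k ^ 3) n inj_f _ _) _.
  - by rewrite ltnS leq_addl.
  - by rewrite ltnS leq_addr.
  - by rewrite ler_wpM2l// tail_prod_le_mean.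
pose K := (1 + 4 * expR 2 * P%:R ^+ 2) * B ^+ k.
have pair_le (m : 'I_P) (ij : 'I_k * 'I_k) :
    \sum_(f : {ffun 'I_k -> 'I_h.+1} | injectiveb f && [forall l, A m (f l)]) w f ij <= K.
  have Bk_ge0 : 0 <= B ^+ k by rewrite exprn_ge0.
  have c_ge0 : 0 <= 4 * expR 2 * P%:R ^+ 2 :> R.
    by rewrite !mulr_ge0 ?expR_ge0 ?exprn_ge0.
  case: ij => i j; rewrite /w /=; case: (boolP (j < i)%N) => [lt_ji|_] /=; last first.
    apply: (@le_trans _ _ (B ^+ k)); last by rewrite /K mulrDl mul1r lerDl mulr_ge0.
    apply: le_trans (sum_ffun_all k (card_A m)).
    rewrite [leLHS]big_mkcond [leRHS]big_mkcond; apply: ler_sum => f _.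
    by case: (injectiveb f) => //=; case: ifP.
  have ij : i != j by apply: contraTneq lt_ji => ->; rewrite ltnn.
  pose G (x y : 'I_h.+1) : R := tail_weight R k n (dist x y) ^+ (k * k).
  have G_ge0 x y : 0 <= G x y by rewrite exprn_ge0 ?tail_weight_ge0.
  have G_le y : \sum_(x | x != y) G x y <= 2 * (h%:R * expR 2).
    rewrite -(big_mkord (fun x => x != y :> nat)
      (fun x => tail_weight R k n (dist x y) ^+ (k * k))).
    apply: le_trans (@sum_dist_le R (fun d => tail_weight R k n d ^+ (k * k)) h y _ _) _.
    - by move=> d; rewrite exprn_ge0 ?tail_weight_ge0.
    - by rewrite -ltnS.
    - by rewrite ler_wpM2l// sum_tail_weight_le.
  apply: le_trans (sum_ffun_pair ij (card_A m) G_ge0 G_le) _.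
  rewrite card_ord.
  have k2 : (2 <= k)%N by have := ltn_ord i; have := ltn_ord j; lia.
  have Bk : B ^+ k = B ^+ k.-2 * B ^+ 2 by rewrite -exprD; congr (_ ^+ _); lia.
  have b_ge0 : 0 <= B ^+ k.-2 by rewrite exprn_ge0.
  apply: (@le_trans _ _ (4 * expR 2 * P%:R ^+ 2 * B ^+ k)); last first.
    by rewrite /K ler_wpM2r// lerDr.
  rewrite Bk; move: (B ^+ k.-2) b_ge0 => b b_ge0.
  (* There are [h.+1 <= 2 h] values at [j], each with a sum over [i] of at most [2 h * expR 2]; then
     [h ^ 2 <= P ^ 2 * B ^ 2] restores the full power of [B]. *)
  have h1 : h.+1%:R <= 2 * h%:R :> R by rewrite -natrM ler_nat; lia.
  have hh : h%:R ^+ 2 <= P%:R ^+ 2 * B ^+ 2 :> R.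
    by rewrite -exprMn; apply: lerXn2r; rewrite // nnegrE// mulr_ge0// ltW.
  have e0 := @expR_ge0 R 2.
  have -> : 4 * expR 2 * P%:R ^+ 2 * (b * B ^+ 2) =
    4 * expR 2 * b * (P%:R ^+ 2 * B ^+ 2) by ring.
  apply: (@le_trans _ _ (4 * expR 2 * b * h%:R ^+ 2)).
    have -> : 4 * expR 2 * b * h%:R ^+ 2 = (2 * h%:R) * (2 * (h%:R * expR 2) * b) by ring.
    by rewrite ler_wpM2r// !mulr_ge0.
  by rewrite ler_wpM2l// !mulr_ge0.
apply: (@le_trans _ _ (\sum_(f : {ffun 'I_k -> 'I_h.+1} |
    injectiveb f && [forall i, (0 < f i)%N])
    \sum_(m < P | [forall l, A m (f l)]) W * ((\sum_ij w f ij) / (k * k)%:R))).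
  exact: ler_sum.
apply: (@le_trans _ _ (\sum_(m < P) W / (k * k)%:R * \sum_(ij : 'I_k * 'I_k)
   \sum_(f : {ffun 'I_k -> 'I_h.+1} | injectiveb f && [forall l, A m (f l)]) w f ij)).
  rewrite (exchange_big_dep xpredT)//=; apply: ler_sum => m _.
  rewrite exchange_big mulr_sumr /= big_mkcond [leRHS]big_mkcond; apply: ler_sum => f _.
  case: (injectiveb f) => //=; case: ifP => [/andP[_ ->]|_].
    by rewrite mulrA mulrAC.
  by case: ifP => // _; rewrite mulr_ge0 ?sumr_ge0// divr_ge0// ltW.
apply: (@le_trans _ _ (\sum_(m < P) W / (k * k)%:R * \sum_(ij : 'I_k * 'I_k) K)).
  apply: ler_sum => m _; rewrite ler_wpM2l ?divr_ge0// ?(ltW kk)//.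
  exact: ler_sum.
rewrite !sumr_const card_prod !card_ord -[K *+ _]mulr_natl mulrA divfK ?gt_eqF//.
by rewrite -mulr_natl /K !mulrA le_eqVlt; apply/orP; left; apply/eqP; ring.
Qed.

Lemma Tsum_ge0 (R : realType) (k h : nat) : 0 <= Tsum R k h.
Proof.
apply: sumr_ge0 => f /andP[/injectiveP inj_f _].
by have /andP[] := @singular_series_le R k h f h.+1 inj_f (ltnSn h).
Qed.

Lemma Tsum_small (R : realType) (k h : nat) : (h < k)%N -> Tsum R k h = 0.
Proof.
move=> lt_hk; apply: big1 => f /andP[/injectiveP inj_f /forallP f_gt0].
have : (#|'I_k| <= #|'I_h|)%N.
  have lt_f i : ((f i).-1 < h)%N by rewrite -ltnS prednK ?f_gt0// ltn_ord.
  apply: (@leq_card _ _ (fun i => Ordinal (lt_f i))) => i j [] e.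
  apply: inj_f; apply: val_inj; rewrite /= -(prednK (f_gt0 i)) e prednK//.
by rewrite !card_ord leqNgt lt_hk.
Qed.

Lemma Tsum_le (R : realType) (P : nat) : (0 < P)%N ->
  exists2 C : R, 0 < C & forall k h : nat, (1 <= k)%N -> (1 <= h)%N ->
    `|Tsum R k h| <= C * (((totient P)%:R / P%:R) ^+ k * (h%:R ^+ k *
      \prod_(0 <= p < (k ^ 3).+1 | prime p) (1 / (1 - 1 / p%:R) ^+ k))).
Proof.
move=> P_gt0; have P_gt0R : (0 : R) < P%:R by rewrite ltr0n.
exists (P%:R * (1 + 4 * expR 2 * P%:R ^+ 2) * expR P%:R).
  by rewrite !mulr_gt0 ?expR_gt0// addr_gt0// !mulr_gt0 ?expR_gt0.
move=> k h k_gt0 h_gt0; rewrite ger0_norm ?Tsum_ge0//.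
set W := \prod_(0 <= p < _ | prime p) _.
have W_ge0 : 0 <= W.
  apply: prodr_ge0 => p prp.
  by rewrite divr_ge0 ?exprn_ge0 ?(ltW (prime_factor_gt0 _ prp)).
set c := P%:R * (1 + _); have c_ge0 : 0 <= c.
  by rewrite mulr_ge0// addr_ge0// !mulr_ge0 ?expR_ge0 ?exprn_ge0.
set r := (totient P)%:R / _; have r_ge0 : 0 <= r by rewrite divr_ge0.
(* By pigeonhole the sum is empty for [h < k]; otherwise [k * (P / h) <= P], which keeps the
   constant dependent on [P] alone. *)
have [lt_hk|le_kh] := ltnP h k.
  by rewrite Tsum_small// !mulr_ge0 ?expR_ge0 ?exprn_ge0.
apply: le_trans (@Tsum_le_sieve R k h P k_gt0 le_kh P_gt0) _; rewrite -/W -/c -/r.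
have h0 : (0 : R) < h%:R by rewrite ltr0n.
have pow_le : (h%:R + P%:R) ^+ k <= h%:R ^+ k * expR P%:R :> R.
  have -> : h%:R + P%:R = h%:R * (1 + P%:R / h%:R) :> R by field; rewrite gt_eqF.
  rewrite exprMn ler_wpM2l ?exprn_ge0//.
  apply: (@le_trans _ _ (expR (P%:R / h%:R) ^+ k)).
    by apply: lerXn2r; rewrite ?nnegrE ?expR_ge0 ?expR_ge1Dx// addr_ge0// divr_ge0.
  rewrite -expRM_natl ler_expR mulrCA ler_piMr// ler_pdivrMr// mul1r ler_nat//.
have -> : c * expR P%:R * (r ^+ k * (h%:R ^+ k * W)) =
  c * (r ^+ k * (h%:R ^+ k * expR P%:R)) * W by ring.
rewrite ler_wpM2r// ler_wpM2l// exprMn ler_wpM2l// exprn_ge0//.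
Qed.

Theorem theorem1p2 (R : realType) :
  (exists C : R, 0 < C /\
     forall k h : nat, (1 <= k)%N -> (1 <= h)%N ->
       `|Tsum R k h| <=
         C * (h%:R ^+ k *
              \prod_(0 <= p < (k ^ 3).+1 | prime p)
                 (1 / (1 - 1 / p%:R) ^+ k)))
  /\
  (exists C : R, 0 < C /\
     forall k h : nat, (2 <= k)%N -> (1 <= h)%N ->
       `|Tsum R k h| <= C * (h%:R ^+ k * (3%:R * ln (k%:R : R)) ^+ k)).
Proof.
split.
  have [C C_gt0 C_le] := @Tsum_le R 1 isT; exists C; split=> // k h k_gt0 h_gt0.
  have := C_le k h k_gt0 h_gt0.
  by rewrite -[totient 1]/1%N divff ?oner_eq0// expr1n mul1r.
have [M M_gt0 M_le] := mertens_upper R.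
(* [P] depends only on the Mertens constant [M], so [C] below stays absolute. *)
have [|P P_gt0 P_le] := @totient_ratio_small R (1 / M); first by rewrite divr_gt0.
have [C C_gt0 C_le] := @Tsum_le R P P_gt0; exists C; split=> // k h k2 h_gt0.
apply: le_trans (C_le k h (ltnW k2) h_gt0) _; rewrite ler_wpM2l ?(ltW C_gt0)//.
rewrite mulrCA ler_wpM2l ?exprn_ge0//.
have k1 : (1 : R) < k%:R by rewrite ltr1n.
have ln_k3 : ln (k ^ 3)%N%:R = 3%:R * ln (k%:R : R).
  by rewrite natrX lnXn ?(lt_trans _ k1)// mulr_natl.
have ln_ge0 : 0 <= 3%:R * ln (k%:R : R) by rewrite mulr_ge0// ln_ge0// ltW.
have k3 : (2 <= k ^ 3)%N by rewrite (leq_trans k2)// -[leqLHS]expn1 leq_pexp2l// ltnW.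
have := M_le (k ^ 3)%N k3; rewrite ln_k3 => prod_le.
have -> : \prod_(0 <= p < (k ^ 3).+1 | prime p) (1 / (1 - 1 / p%:R) ^+ k) =
    (\prod_(0 <= p < (k ^ 3).+1 | prime p) (1 / (1 - 1 / p%:R))) ^+ k :> R.
  by rewrite -prodrXl; apply: eq_bigr => p _; rewrite expr_div_n expr1n.
set Q := \prod_(0 <= p < _ | prime p) _ in prod_le *.
have Q_ge0 : 0 <= Q.
  by apply: prodr_ge0 => p prp; rewrite divr_ge0// ltW// prime_factor_gt0.
have r_ge0 : 0 <= (totient P)%:R / P%:R :> R by rewrite divr_ge0.
rewrite -exprMn; apply: lerXn2r; rewrite ?nnegrE//; first exact: mulr_ge0.
(* Here [1 / M] cancels [M] and leaves exactly [ln (k ^ 3) = 3 ln k]. *)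
apply: le_trans (ler_pM r_ge0 Q_ge0 P_le prod_le) _.
by rewrite div1r mulKf ?gt_eqF.
Qed.
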